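(* Let $G$ be a countably infinite group. For every Borel action $G \curvearrowright X$ on a standard Borel space $X$ and every quasi-invariant Borel measure $\mu$ on $X$, there is a quasi-invariant Borel measure $\nu$ on $4^G$ such that $G \curvearrowright (4^G,\nu)$ factors onto $G \curvearrowright (X,\mu)$.
   Context: $4^G$ denotes the set of functions $x : G \to \{1,2,3,4\}$ with the product topology and the left shift action $(g\cdot x)(h) = x(g^{-1}h)$ of $G$. A Borel measure $\mu$ on $X$ is quasi-invariant for $G \curvearrowright X$ if translates of $\mu$-null sets by elements of $G$ are $\mu$-null; quasi-invariant measures need not be finite or $\sigma$-finite. $G \curvearrowright (Y,\nu)$ factors onto $G \curvearrowright (X,\mu)$ if there is a $G$-equivariant $\nu$-almost-everywhere defined Borel map $\phi : Y \to X$ such that $\nu$ pushes forward to $\mu$. *)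

(* Defs.v *)
From HB Require Import structures.
From mathcomp Require Import all_boot all_order all_algebra.
From mathcomp Require Import all_classical all_reals all_analysis.

Set Implicit Arguments.
Unset Strict Implicit.
Unset Printing Implicit Defensive.

Local Open Scope classical_set_scope.
Local Open Scope ring_scope.
Local Open Scope ereal_scope.

(* [M] is not assumed pointed, so [cvg] and [completePseudoMetricType] do not
   apply. *)
Definition complete_separable (R : realType) (M : metricType R) : Prop :=
  (forall F : set_system M, ProperFilter F -> cauchy F ->
    exists x : M, F --> x) /\
  (exists2 S : set M, countable S & dense S).

(* The sigma-algebra of X is the Borel sigma-algebra of a Polish topology,
   transported to X along the bijection f. *)
Definition standard_borel (R : realType) d (X : measurableType d) : Prop :=
  exists (M : metricType R) (f : X -> M),
    [/\ complete_separable M, bijective f &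
        forall A : set X, measurable A <-> <<s (@open M) >> (f @` A)].

(* The groups considered are countable and discrete, so an action is Borel
   iff every group element acts by a Borel map. *)
Record borel_action (G : groupType) d (X : measurableType d)
    (a : G -> X -> X) : Prop := {
  borel_action1 : forall x, a 1%g x = x ;
  borel_actionM : forall g h x, a (g * h)%g x = a g (a h x) ;
  borel_action_measurable : forall g, measurable_fun setT (a g) }.

Definition quasi_invariant (R : realType) (G : groupType) d
    (X : measurableType d) (a : G -> X -> X)
    (mu : {measure set X -> \bar R}) : Prop :=
  forall (g : G) (A : set X), mu.-negligible A -> mu.-negligible (a g @` A).

(* The a.e. defined map is [phi] restricted to the conull set [D], outside of
   which its values are junk. *)
Definition factors_onto (R : realType) (G : groupType)
    d1 (Y : measurableType d1) (b : G -> Y -> Y)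
    (nu : {measure set Y -> \bar R})
    d2 (X : measurableType d2) (a : G -> X -> X)
    (mu : {measure set X -> \bar R}) : Prop :=
  exists (D : set Y) (phi : Y -> X),
    [/\ measurable D, nu (~` D) = 0, measurable_fun D phi,
        forall g y, D y -> D (b g y) /\ phi (b g y) = a g (phi y) &
        forall A : set X, measurable A -> nu (D `&` phi @^-1` A) = mu A].

(* The symbols 1, 2, 3, 4 are encoded as the elements 0, 1, 2, 3 of 'I_4. *)
Definition four_topology (G : Type) := {ptws G -> discrete_topology 'I_4}.

HB.instance Definition _ (G : Type) := Topological.on (four_topology G).
HB.instance Definition _ (G : Type) :=
  isPointed.Build (four_topology G) (fun=> ord0).

(* 4^G with its Borel sigma-algebra. *)
Definition four_shift (G : Type) :=
  g_sigma_algebraType (@open (four_topology G)).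

Definition left_shift (G : groupType) (g : G) (x : four_shift G) :
    four_shift G :=
  fun h => x (g^-1 * h)%g.

(* Main.v *)
Require Import Defs.
From mathcomp Require Import all_boot all_order all_algebra.
From mathcomp Require Import all_classical all_reals all_analysis.
From mathcomp Require Import lra.

Import Order.TTheory GRing.Theory Num.Theory.

Local Open Scope classical_set_scope.
Local Open Scope ring_scope.
Local Open Scope ereal_scope.

(** Two observations carry the proof.

    First, quasi-invariance costs nothing once a factor map has a section.
    Let phi : D -> X be an equivariant Borel map on an invariant Borel set D
    of a G-space Y, and let sigma : X -> D be any Borel section of phi; it
    is rarely equivariant.  Every conjugate g sigma g^-1 is again a section of
    phi, because phi is equivariant.  Hence a weighted sum
      nu = \sum_g c_g (g sigma g^-1)_* mu   with c_g > 0 and \sum_g c_g = 1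
    still pushes forward to mu, even when mu is infinite.  Translating by a
    group element permutes the measures (g sigma g^-1)_* mu up to a translation
    of X, which preserves the null sets of mu, and the positive weights do not
    affect null sets; so nu is quasi-invariant
    ([exists_quasi_invariant_lift]).

    Second, 4^G has a Borel set W that meets every orbit at most once, along
    points with trivial stabilizer: view a symbol as a pair of bits, a mark and
    a datum, and let W consist of configurations whose only mark sits at the
    identity.  Any Borel map psi on W extends to an equivariant Borel map on
    the saturation of W by g y |-> g psi(y) ([equivariant_extension]).  As G is
    infinite, the data bits of a point of W can spell an arbitrary element of
    2^(N x N), so it only remains to code the points of X by such elements,
    with a Borel decoding.

    A point x of a separable complete metric space with dense sequence s is
    coded by the set of pairs (k, n) with d (s n) x < 1/(k+1). A set of pairs
    is called valid when it selects balls of all radii 1/(k+1) and the centres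
    of any two selected balls are closer than the sum of the radii. Validity
    is a Borel condition, every valid set determines one point by
    completeness, and this point lies in an open set U iff one of the selected
    closed balls is contained in U. So decoding is Borel on the set of all
    valid codes, which contains the codes of all points
    ([standard_borel_code]). *)

(** * Measurability of countable combinations *)

Lemma countable_bigcap_measurable d (T : measurableType d) (U : Type)
    (F : U -> set T) : countable [set: U] ->
  (forall i, measurable (F i)) -> measurable (\bigcap_i F i).
Proof.
move=> cU mF; rewrite -[X in measurable X]setCK setC_bigcap.
apply/measurableC/countable_bigcupT_measurable => // i.
exact/measurableC.
Qed.

Lemma measurable_const_set d (T : measurableType d) (P : Prop) :
  measurable [set _ : T | P].
Proof.
have [p|np] := pselect P.
  by rewrite (_ : [set _ | _] = setT) //; apply/seteqP; split.
by rewrite (_ : [set _ | _] = set0) //; apply/seteqP; split.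
Qed.

Lemma measurableT_preimage d1 (T1 : measurableType d1) d2
    (T2 : measurableType d2) (f : T1 -> T2) (A : set T2) :
  measurable_fun setT f -> measurable A -> measurable (f @^-1` A).
Proof. by move=> mf mA; rewrite -[X in measurable X]setTI; exact: mf. Qed.

(** * Coding the points of a Polish space by sets of balls *)

Lemma mdist_ball_open (R : realType) (M : metricType R) (x : M) (e : R) :
  open (ball x e).
Proof.
rewrite openE ballEmdist => y /= xy; apply/nbhs_ballP.
exists (e - mdist x y)%R; first by rewrite /= subr_gt0.
move=> z; rewrite ballEmdist/= ltrBrDl => /(le_lt_trans _); apply.
exact: metric_triangle.
Qed.

Section BallCode.
Local Open Scope ring_scope.
Context {R : realType} {M : metricType R}.
Variable s : nat -> M.
Hypothesis s_dense : forall (x : M) (e : R), 0 < e ->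
  exists n, mdist (s n) x < e.
Hypothesis M_complete : forall F : set_system M, ProperFilter F -> cauchy F ->
    exists x : M, F --> x.

Let r (p : nat * nat) : R := p.1.+1%:R^-1.

Let r_gt0 p : 0 < r p. Proof. by rewrite /r invr_gt0. Qed.

Let r_small (e : R) : 0 < e -> exists k, forall l n, (k <= l)%N -> r (l, n) < e.
Proof.
move=> e0; near \oo => k; exists k => l n kl.
apply: (@le_lt_trans _ _ (k.+1%:R^-1)).
  by rewrite /r/= lef_pV2 ?posrE// ler_nat.
by near: k; exact: near_infty_natSinv_lt (PosNum e0).
Unshelve. all: by end_near. Qed.

Definition ball_code (x : M) : set (nat * nat) :=
  [set p | mdist (s p.2) x < r p].

(** Codes are tested only through pairs of selected balls, so that validity is a
    countable Boolean combination of the events c p.  Not every valid code is a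
    [ball_code]. *)
Definition valid_code : set (set (nat * nat)) :=
  [set c | (forall k, exists n, c (k, n)) /\
           forall p q, c p -> c q -> mdist (s p.2) (s q.2) < r p + r q].

(** The point described by a valid code; closed balls, because the strict
    inequalities between the centres become weak ones in the limit. *)
Definition code_point (c : set (nat * nat)) (x : M) :=
  forall p, c p -> mdist (s p.2) x <= r p.

Lemma valid_ball_code x : valid_code (ball_code x).
Proof.
split=> [k|p q]; first exact: s_dense (r_gt0 (k, 0%N)).
rewrite /ball_code/= => xp xq.
by rewrite (le_lt_trans (metric_triangle _ x _))// ltrD// metric_sym.
Qed.

Lemma code_point_ball_code x : code_point (ball_code x) x.
Proof. by move=> p /ltW. Qed.

Lemma code_point_inj c x y : valid_code c ->
  code_point c x -> code_point c y -> x = y.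
Proof.
move=> [ec _] cx cy; apply: mdist_positivity; apply/eqP.
rewrite eq_le mdist_ge0 andbT leNgt; apply/negP => xy0.
have [k /(_ k) rk] := r_small _ (divr_gt0 xy0 (ltr0Sn _ 1)).
have [n cn] := ec k.
have := metric_triangle x (s n) y.
have := cx _ cn; have := cy _ cn; have := rk n (leqnn k).
rewrite /= (metric_sym x (s n)); lra.
Qed.

(** The centres of one selected ball of each radius form a Cauchy sequence.  Its
    limit is in every selected ball p, since balls of radius tending to 0 around
    the centres all come close to p. *)
Lemma code_point_ex c : valid_code c -> exists x, code_point c x.
Proof.
move=> [/choice[n cn] cc].
pose u k := s (n k).
have [] := M_complete (u @ \oo).
  apply: cauchy_exP => e e0.
  have [k rk] := r_small _ (divr_gt0 e0 (ltr0Sn _ 1)).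
  exists (u k); exists k => // l /= kl.
  rewrite ballEmdist/= (lt_trans (cc _ _ (cn k) (cn l)))//.
  have := rk k (n k) (leqnn k); have := rk l (n l) kl; lra.
move=> x ux; exists x => p cp.
rewrite leNgt; apply/negP => px.
have e0 : 0 < (mdist (s p.2) x - r p) / 2 by rewrite divr_gt0// subr_gt0.
have [k rk] := r_small _ e0.
have [k' _ uk'] := (ux _ (nbhsx_ballx x _ e0)).
pose l := maxn k k'.
have := uk' l (leq_maxr _ _); have := rk l (n l) (leq_maxl _ _).
have := cc _ _ cp (cn l); have := metric_triangle (s p.2) (u l) x.
rewrite /= ballEmdist/= /u (metric_sym x); lra.
Qed.

(** This is why decoding is Borel: lying in an open set is witnessed by a single
    one of the countably many selected balls. *)
Lemma code_point_openP c x (U : set M) : valid_code c -> code_point c x ->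
  open U ->
  U x <-> exists p, c p /\ [set y | mdist (s p.2) y <= r p] `<=` U.
Proof.
move=> [ec _] cx oU; split; last by move=> [p [cp]]; apply; exact: cx.
move=> Ux; have := open_nbhs_nbhs (conj oU Ux).
move=> /nbhs_ballP[e /= e0 xeU].
have [k /(_ k) rk] := r_small _ (divr_gt0 e0 (ltr0Sn _ 1)).
have [n cn] := ec k; exists (k, n); split => // y /= ny; apply: xeU.
rewrite ballEmdist/=.
have := cx _ cn; have := metric_triangle x (s n) y; have := rk n (leqnn k).
rewrite /= (metric_sym x (s n)); lra.
Qed.

Lemma open_ball_code p : open [set x | ball_code x p].
Proof.
suff -> : [set x | ball_code x p] = ball (s p.2) (r p).
  exact: mdist_ball_open.
by rewrite ballEmdist.
Qed.

End BallCode.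

Lemma separable_dense_seq (R : realType) (M : metricType R) (x0 : M) :
  (exists2 S : set M, countable S & dense S) ->
  exists s : nat -> M, forall x e, (0 < e)%R -> exists n, (mdist (s n) x < e)%R.
Proof.
move=> [S /countable_injP[i i_inj] dS].
exists (fun n => xget x0 [set y | S y /\ i y = n]) => x e e0.
have [] := dS (ball x e); first by exists x; exact: ballxx.
  exact: mdist_ball_open.
move=> y [xy Sy]; exists (i y).
case: xgetP => [z _ [Sz /i_inj zy]|/(_ y)/=]; last by case.
by rewrite zy ?inE// metric_sym; rewrite ballEmdist in xy.
Qed.

(** Codes carry no sigma-algebra here: decoding is Borel in the sense that its
    composition with any family of measurable bits is measurable. *)
Lemma standard_borel_code (R : realType) d (X : measurableType d) :
  standard_borel R X ->
  exists (code : X -> set (nat * nat)) (valid : set (set (nat * nat)))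
         (decode : set (nat * nat) -> X),
  [/\ forall p, measurable [set x | code x p],
      forall x, valid (code x),
      forall x, decode (code x) = x &
      forall d' (Y : measurableType d') (b : Y -> set (nat * nat)),
        (forall p, measurable [set y | b y p]) ->
        measurable (b @^-1` valid) /\
        measurable_fun (b @^-1` valid) (decode \o b)].
Proof.
move=> [M [f [[M_complete /(separable_dense_seq _ _ (f point))[s s_dense]]]]].
move=> [g fK gK] mX.
pose code x := ball_code s (f x).
pose dec c := xget point [set x | code_point s c (f x)].
have decP c : valid_code s c -> code_point s c (f (dec c)).
  move=> vc; have [x cx] := code_point_ex s M_complete c vc.
  by rewrite /dec; case: xgetP => // /(_ (g x)); rewrite /= gK.
exists code, (valid_code s), dec; split => [p|x|x|d' Y b mb].
- apply/mX; rewrite (_ : f @` _ = [set y | ball_code s y p]).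
    by apply: sub_sigma_algebra; exact: open_ball_code.
  apply/seteqP; split => [_ [x cx <-]//|y cy]; exists (g y); rewrite ?gK//.
  by rewrite /code/= gK.
- exact: valid_ball_code.
- apply: (can_inj fK); apply: (code_point_inj s (code x)).
  + exact: valid_ball_code.
  + exact/decP/valid_ball_code.
  + exact: code_point_ball_code.
set D := b @^-1` _.
have mD : measurable D.
  rewrite (_ : D = \bigcap_k (\bigcup_n [set y | b y (k, n)]) `&`
    \bigcap_p \bigcap_q (~` ([set y | b y p] `&` [set y | b y q]) `|`
      [set _ | (mdist (s p.2) (s q.2) < p.1.+1%:R^-1 + q.1.+1%:R^-1)%R])).
    apply: measurableI.
      by apply: bigcapT_measurable => k; apply: bigcupT_measurable.
    apply: countable_bigcap_measurable => // p.
    apply: countable_bigcap_measurable => // q.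
    apply: measurableU; last exact: measurable_const_set.
    exact/measurableC/measurableI.
  apply/seteqP; split => y /=.
    move=> [by1 by2]; split.
      by move=> k _; have [n bn] := by1 k; exists n.
    move=> p _ q _ /=.
    have [[bp bq]|] := pselect (b y p /\ b y q); last by left.
    by right; exact: by2.
  move=> [by1 by2]; split.
    by move=> k; have [n _ bn] := by1 k I; exists n.
  by move=> p q bp bq; have [] := by2 p I q I => // /(_ (conj bp bq)).
split=> // _ A mA.
(* The sets with measurable preimage form a sigma-algebra. *)
pose E := [set N : set M | measurable (D `&` [set y | N (f (dec (b y)))])].
have sE : sigma_algebra setT E.
  split.
  - by rewrite /E/= (_ : [set y | _] = set0) // setI0.
  - move=> N EN; rewrite /E/= (_ : D `&` _ =
      D `\` (D `&` [set y | N (f (dec (b y)))])); first exact: measurableD.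
    apply/seteqP; split => y /= [Dy]; first by move=> [_ nN]; split => // -[].
    by move=> nN; split => //; split => // Ny; exact: nN.
  - move=> F EF; rewrite /E/= (_ : [set y | _] =
      \bigcup_n [set y | F n (f (dec (b y)))]) // setI_bigcupr.
    exact: bigcupT_measurable.
have oE : @open M `<=` E.
  move=> U oU; rewrite /E/= (_ : D `&` _ = D `&` \bigcup_(p in
    [set p | [set y | mdist (s p.2) y <= p.1.+1%:R^-1]%R `<=` U])
      [set y | b y p]).
    apply: measurableI => //; rewrite bigcup_mkcond.
    by apply: countable_bigcupT_measurable => // p; case: ifP.
  apply/seteqP; split => y /= [Dy].
    move=> /(code_point_openP s _ _ _ Dy (decP _ Dy) oU)[p [bp pU]].
    by split => //; exists p.
  move=> [p pU bp]; split => //.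
  by apply/(code_point_openP s _ _ _ Dy (decP _ Dy) oU); exists p.
have -> : D `&` (dec \o b) @^-1` A =
    D `&` [set y | (f @` A) (f (dec (b y)))].
  congr setI; apply/seteqP; split => y /=; first by exists (dec (b y)).
  by move=> [x Ax /(can_inj fK) <-].
suff : E (f @` A) by [].
apply: (smallest_sub sE oE); exact: (mX A).1.
Qed.

(** * The Borel structure of the shift space *)

Lemma open_symbol_cylinder (G : groupType) (h : G) (i : 'I_4) :
  @open (four_topology G) [set y | y h = i].
Proof.
pose p (y : four_topology G) : discrete_topology 'I_4 := y h.
have /continuousP pc : continuous p :=
  @proj_continuous G (fun=> discrete_topology 'I_4) h.
exact/(pc [set i])/discrete_open.
Qed.

Lemma measurable_symbol_cylinder (G : groupType) (h : G) (i : 'I_4) :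
  measurable [set y : four_shift G | y h = i].
Proof. by apply: sub_sigma_algebra; exact: open_symbol_cylinder. Qed.

Lemma measurable_symbol (G : groupType) (h : G) (P : 'I_4 -> Prop) :
  measurable [set y : four_shift G | P (y h)].
Proof.
rewrite (_ : [set y | _] =
  \bigcup_(i in P) [set y : four_shift G | y h = i]).
  rewrite bigcup_mkcond; apply: countable_bigcupT_measurable => // i.
  by case: ifP => // _; exact: measurable_symbol_cylinder.
by apply/seteqP; split => y /= => [Py|[i Pi ->]//]; exists (y h).
Qed.

(** Otherwise there are points outside U agreeing with y on longer and longer
    initial segments of G, and they converge pointwise to y. *)
Lemma open_four_cylinder (G : groupType) (e : nat -> G)
    (e_surj : forall h, exists n, e n = h)
    (U : set (four_topology G)) (y : four_topology G) : open U -> U y ->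
  exists N, [set z | forall n, (n < N)%N -> z (e n) = y (e n)] `<=` U.
Proof.
move=> oU Uy; apply: contrapT => /forallNP nU.
have /choice[z zP] N : exists z : four_topology G,
    (forall n, (n < N)%N -> z (e n) = y (e n)) /\ ~ U z.
  by have /existsNP[z /not_implyP] := nU N; exists z.
have zy : z @ \oo --> y.
  apply/(@pointwise_cvgP (discrete_topology G) (discrete_topology 'I_4)) => h.
  have [n <-] := e_surj h; apply: cvg_near_cst; exists n.+1 => // N nN.
  exact: (zP N).1.
have [N _ /(_ N (leqnn N))] := zy U (open_nbhs_nbhs (conj oU Uy)).
exact: (zP N).2.
Qed.

Lemma countable_group_enum (G : groupType) : countable [set: G] ->
  exists e : nat -> G, forall h, exists n, e n = h.
Proof.
move=> /countable_injP[i i_inj].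
exists (fun n => xget 1%g [set h | i h = n]) => h; exists (i h).
case: xgetP => [k _ /= ik|/(_ h) /(_ erefl)//].
by apply: i_inj; rewrite ?inE.
Qed.

(** For countable G an open set is the union of the cylinders it contains, and
    the cylinders are indexed by the countable set of words. *)
Lemma measurable_fun_four_shift (G : groupType) d (T : measurableType d)
    (f : T -> four_shift G) : countable [set: G] ->
  (forall h i, measurable [set x | f x h = i]) -> measurable_fun setT f.
Proof.
move=> /countable_group_enum[e e_surj] mf.
pose O : set (set (four_shift G)) := @open (four_topology G).
apply: (measurability O) => //.
move=> _ [U oU <-]; rewrite setTI.
pose cyl (w : seq 'I_4) : set (four_shift G) :=
  [set z | forall n, (n < size w)%N -> z (e n) = nth ord0 w n].
rewrite (_ : f @^-1` U =
    \bigcup_(w in [set w | cyl w `<=` U]) (f @^-1` cyl w)).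
  rewrite bigcup_mkcond; apply: countable_bigcupT_measurable => // w.
  case: ifP => // _.
  rewrite (_ : _ @^-1` _ = \bigcap_(n in [set n | (n < size w)%N])
      [set x | f x (e n) = nth ord0 w n]) //.
  exact: bigcap_measurableType.
apply/seteqP; split => x /=; last by move=> [w wU fxw]; exact: wU.
move=> Ux.
have [N NU] := open_four_cylinder G e e_surj U (f x) oU Ux.
have szw : size (mkseq (fun n => f x (e n)) N) = N by rewrite size_mkseq.
exists (mkseq (fun n => f x (e n)) N); last first.
  by move=> n; rewrite szw => nN; rewrite nth_mkseq.
move=> z /= zw; apply: NU => n nN.
by rewrite zw ?szw// nth_mkseq.
Qed.

Lemma left_shift_borel (G : groupType) : countable [set: G] ->
  borel_action (@left_shift G).
Proof.
move=> cG; split => [x|g h x|g].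
- by apply/funext => h; rewrite /left_shift invg1 mul1g.
- by apply/funext => k; rewrite /left_shift invgM mulgA.
- apply: measurable_fun_four_shift => // h i.
  exact: measurable_symbol_cylinder.
Qed.

(** * Equivariant maps defined on a transversal *)

(** The assumption on W says that distinct translates of W are disjoint: each
    point y of the saturation has exactly one k with k y in W, and
    phi y = k^-1 psi (k y) is the only possible equivariant value. *)
Lemma equivariant_extension (G : groupType) (G_countable : countable [set: G])
    d1 (Y : measurableType d1) (b : G -> Y -> Y) (b_borel : borel_action b)
    d2 (X : measurableType d2) (a : G -> X -> X) (a_borel : borel_action a)
    (W : set Y) (psi : Y -> X) :
  measurable W -> measurable_fun W psi ->
  (forall g y, W y -> W (b g y) -> g = 1%g) ->
  exists (D : set Y) (phi : Y -> X),
    [/\ measurable D, measurable_fun D phi, W `<=` D,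
        {in W, phi =1 psi} &
        forall g y, D y -> D (b g y) /\ phi (b g y) = a g (phi y)].
Proof.
move=> mW mpsi W1.
have [b1 bM mb] := b_borel; have [a1 aM ma] := a_borel.
pose phi y := let k := xget 1%g [set k | W (b k y)] in
  a (k^-1)%g (psi (b k y)).
have phiE k y : W (b k y) -> phi y = a (k^-1)%g (psi (b k y)).
  move=> Wk; rewrite /phi; case: xgetP => [l _ /= Wl|/(_ k) /(_ Wk)//].
  suff -> : l = k by [].
  have /(W1 _ _ Wk) lk1 : W (b (l * k^-1)%g (b k y)) by rewrite -bM mulgVK.
  by rewrite -(mulgVK k l) lk1 mul1g.
exists (\bigcup_k (b k @^-1` W)), phi.
have mD : measurable (\bigcup_k (b k @^-1` W)).
  apply: countable_bigcupT_measurable => // k.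
  exact: measurableT_preimage.
split => //.
- move=> _ A mA.
  rewrite (_ : _ `&` _ = \bigcup_k (b k @^-1`
      (W `&` psi @^-1` (a (k^-1)%g @^-1` A)))).
    apply: countable_bigcupT_measurable => // k.
    apply: measurableT_preimage => //; apply: mpsi => //.
    exact: measurableT_preimage.
  apply/seteqP; split => y /=.
    by move=> [[k _ /= Wk]]; rewrite (phiE k)// => Ay; exists k.
  move=> [k _ [Wk Ay]]; split; first by exists k.
  by rewrite (phiE k).
- by move=> y Wy; exists 1%g => //=; rewrite b1.
- move=> y /set_mem Wy.
  by rewrite (phiE 1%g) b1 ?invg1 ?a1.
- move=> g y [k _ /= Wk].
  have Wkg : W (b (k * g^-1)%g (b g y)) by rewrite -bM mulgVK.
  split; first by exists (k * g^-1)%g.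
  by rewrite (phiE _ _ Wkg) (phiE _ _ Wk) -bM mulgVK invgM invgK aM.
Qed.

(** * Quasi-invariant lifts of measures *)

Lemma nneseries_eq0 (R : realType) (u : nat -> \bar R) :
  (forall n, 0 <= u n) ->
  \sum_(0 <= n <oo) u n = 0 <-> forall n, u n = 0.
Proof.
move=> u0; split=> [+ n|u_eq0]; last by rewrite eseries0.
rewrite (nneseriesD1 (n := n))// => /eqP.
by rewrite padde_eq0 ?nneseries_ge0// => /andP[/eqP].
Qed.

(** The value x = +oo matters: it is the measure of a set for a measure that is
    not assumed finite. *)
Lemma nneseries_halves (R : realType) (x : \bar R) : 0 <= x ->
  \sum_(0 <= n <oo) ((1 / (2 ^ (n + 1))%:R)%:E * x) = x.
Proof.
move=> x0; pose w n : R := (1 / (2 ^ (n + 1))%:R)%R.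
have w_gt0 n : (0 < w n)%R by rewrite divr_gt0.
have w_sum : \sum_(0 <= n <oo) (w n)%:E = 1.
  have /cvg_lim := @cvg_geometric_eseries_half R 1 0.
  by rewrite expr0 divr1; exact.
case: x x0 => // [x|_].
  rewrite lee_fin => x0.
  under eq_eseriesr do rewrite muleC.
  by rewrite nneseriesZl ?w_sum ?mule1// => n _; rewrite lee_fin ltW// w_gt0.
apply: (@nneseries_pinfty _ _ _ 0%N) => //.
by rewrite gt0_muley// lte_fin w_gt0.
Qed.

(** The measure is the average of the images of mu under the conjugated sections
    tau_n = e_n sigma e_n^-1, where e enumerates G, possibly with repetitions.
    If g^-1 e_n = e_m, then tau_n^-1 (g N) = g (tau_m^-1 N), so shifting a null
    set by g replaces each summand by a translate of another one. *)
Lemma exists_quasi_invariant_lift (R : realType) (G : groupType)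
    (G_countable : countable [set: G])
    d1 (Y : measurableType d1) (b : G -> Y -> Y) (b_borel : borel_action b)
    d2 (X : measurableType d2) (a : G -> X -> X) (a_borel : borel_action a)
    (mu : {measure set X -> \bar R}) (mu_qi : quasi_invariant a mu)
    (D : set Y) (phi : Y -> X) (sigma : X -> Y) :
  measurable D -> measurable_fun D phi ->
  (forall g y, D y -> D (b g y) /\ phi (b g y) = a g (phi y)) ->
  measurable_fun setT sigma ->
  (forall x, D (sigma x)) -> (forall x, phi (sigma x) = x) ->
  exists nu : {measure set Y -> \bar R},
    quasi_invariant b nu /\ factors_onto b nu a mu.
Proof.
move=> mD mphi Dphi msigma Dsigma phisigma.
have [b1 bM mb] := b_borel; have [a1 aM ma] := a_borel.
have [e e_surj] := countable_group_enum G G_countable.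
pose tau n x := b (e n) (sigma (a (e n)^-1%g x)).
have mtau n : measurable_fun setT (tau n).
  apply: (measurableT_comp (mb _)); exact: (measurableT_comp msigma).
have Dtau n x : D (tau n x) by apply: (Dphi _ _ _).1.
have phitau n x : phi (tau n x) = x.
  by rewrite (Dphi _ _ _).2 // phisigma -aM mulgV a1.
have w_gt0 n : (0 < 1 / (2 ^ (n + 1))%:R :> R)%R by rewrite divr_gt0.
pose w n : {nonneg R} := NngNum (ltW (w_gt0 n)).
pose nu : {measure set Y -> \bar R} := mseries (fun n => mscale (w n)
  (measure_function_pushforward__canonical__measure_function_Measure
    mu (mtau n))) 0.
have nuE A : nu A =
  \sum_(0 <= n <oo) ((1 / (2 ^ (n + 1))%:R)%:E * mu (tau n @^-1` A)) by [].
have nu0P A : nu A = 0 <-> forall n, mu (tau n @^-1` A) = 0.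
  rewrite nuE nneseries_eq0; last by move=> n; rewrite mule_ge0// lee_fin ltW.
  split=> A0 n; last by rewrite A0 mule0.
  by have /eqP := A0 n; rewrite mule_eq0 eqe gt_eqF//= => /eqP.
exists nu; split.
  move=> g A [N [mN /nu0P N0 AN]].
  exists (b g^-1%g @^-1` N); split.
  - exact: measurableT_preimage.
  - apply/nu0P => n; have [m em] := e_surj (g^-1 * e n)%g.
    apply: measure_negligible.
      by apply: measurableT_preimage => //; exact: measurableT_preimage.
    rewrite (_ : tau n @^-1` _ = a g @` (tau m @^-1` N)).
      apply: mu_qi; apply/negligibleP; last exact: N0.
      exact: measurableT_preimage.
    apply/seteqP; split => [x /= Nx|_ /= [x Nx <-]].
      exists (a g^-1%g x); last by rewrite -aM mulgV a1.
      by rewrite /tau -aM em invgM invgK mulgK bM.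
    by move: Nx; rewrite /tau em invgM invgK bM aM.
  - by move=> _ [y Ay <-]; rewrite /= -bM mulVg b1; exact: AN.
exists D, phi; split=> //.
- apply/nu0P => n; rewrite (_ : _ @^-1` _ = set0) ?measure0//.
  by apply/seteqP; split => x //=; apply.
- move=> A mA; rewrite nuE -[RHS]nneseries_halves//.
  apply: eq_eseriesr => n _; congr (_ * mu _).
  by apply/seteqP; split => x /=; rewrite phitau => // -[].
Qed.

(** * Marks and data bits *)

Definition marked (i : 'I_4) : bool := (1 < i)%N.

Definition bit (i : 'I_4) : bool := odd i.

Definition symbol (m c : bool) : 'I_4 := inord (m.*2 + c).

Lemma marked_symbol m c : marked (symbol m c) = m.
Proof. by case: m c => -[]; rewrite /marked /symbol inordK. Qed.

Lemma bit_symbol m c : bit (symbol m c) = c.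
Proof. by case: m c => -[]; rewrite /bit /symbol inordK. Qed.

Theorem theorem1p3 (R : realType) (G : groupType)
    (G_countable : countable [set: G]) (G_infinite : infinite_set [set: G])
    (d : measure_display) (X : measurableType d) (X_std : standard_borel R X)
    (a : G -> X -> X) (a_borel : borel_action a)
    (mu : {measure set X -> \bar R}) (mu_qi : quasi_invariant a mu) :
  exists nu : {measure set (four_shift G) -> \bar R},
    quasi_invariant (@left_shift G) nu /\ factors_onto (@left_shift G) nu a mu.
Proof.
have [code [valid [decode [mcode code_valid codeK mdecode]]]] :=
  standard_borel_code R d X X_std.
have shift_borel := left_shift_borel G G_countable.
have [pos pos_inj] : exists pos : nat * nat -> G, injective pos.
  have /card_leP[f] := (infiniteP [set: G]).1 G_infinite.
  exists (fun p => val (f (to_setT (choice.pickle p)))) => p q.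
  have finj : injective f by move=> i j; apply: inj; rewrite inE.
  by move=> /val_inj/finj/(congr1 val)/(pcan_inj choice.pickleK).
(* The bit (k, n) of a code is stored at the group element pos (k, n). *)
pose read (y : four_shift G) : set (nat * nat) := [set p | bit (y (pos p))].
pose W := [set y : four_shift G | forall h, marked (y h) = (h == 1%g)] `&`
  read @^-1` valid.
have mread p : measurable [set y | read y p].
  exact: (measurable_symbol G (pos p) bit).
have [mvalid mdec] := mdecode _ _ read mread.
have mW : measurable W.
  apply: measurableI => //.
  rewrite (_ : [set y | _] =
    \bigcap_h [set y : four_shift G | marked (y h) = (h == 1%g)]).
    apply: countable_bigcap_measurable => // h.
    exact: (measurable_symbol G h (fun i => marked i = (h == 1%g))).
  by apply/seteqP; split => y /= H h => [_|]; [exact: H|exact: (H h I)].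
have W1 g y : W y -> W (left_shift g y) -> g = 1%g.
  move=> [Wy _] [/(_ g)]; rewrite /left_shift mulVg Wy eqxx.
  by move=> /esym/eqP.
have [D [phi [mD mphi WD phiW phiE]]] := equivariant_extension G G_countable
  _ _ _ shift_borel _ _ _ a_borel W _ mW
  (measurable_funS mvalid (@subIsetr _ _ _) mdec) W1.
(* A single mark at the identity gives the point trivial stabilizer. *)
pose sigma x : four_shift G :=
  fun h => symbol (h == 1%g) `[< exists p, code x p /\ pos p = h >].
have read_sigma x : read (sigma x) = code x.
  apply/seteqP; split => p; rewrite /read/= /sigma bit_symbol.
    by move=> /asboolP[q [cq /pos_inj <-]].
  by move=> cp; apply/asboolP; exists p.
have Wsigma x : W (sigma x).
  by split; [move=> h; rewrite marked_symbol|rewrite /= read_sigma].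
apply: (exists_quasi_invariant_lift R G G_countable _ _ _ shift_borel
  _ _ _ a_borel mu mu_qi D phi sigma) => //.
- apply: measurable_fun_four_shift => // h i.
  rewrite (_ : [set x | _] =
    ((\bigcup_(p in [set p | pos p = h]) [set x | code x p]) `&`
      [set _ | symbol (h == 1%g) true = i]) `|`
    (~` (\bigcup_(p in [set p | pos p = h]) [set x | code x p]) `&`
      [set _ | symbol (h == 1%g) false = i])).
    have mB : measurable
        (\bigcup_(p in [set p | pos p = h]) [set x | code x p]).
      rewrite bigcup_mkcond; apply: countable_bigcupT_measurable => // p.
      by case: ifP.
    apply: measurableU; apply: measurableI; try exact: measurable_const_set.
      by [].
    exact: measurableC.
  apply/seteqP; split => x /=; rewrite /sigma.
    case: asboolP => [[p [cp pE]]|nc] si; [left|right]; split => //.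
      by exists p.
    by move=> [p pE cp]; apply: nc; exists p.
  move=> [[[p pE cp] si]|[nc si]].
    by rewrite asboolT//; exists p.
  by rewrite asboolF// => -[p [cp pE]]; apply: nc; exists p.
- by move=> x; exact: WD.
- by move=> x; rewrite phiW ?inE//= read_sigma.
Qed.
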